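(* Let $\leq$ be a dense linear order on a countably infinite set $X$. Then $\mathrm{Aut}(X,{\leq})$ is not skew-amenable with respect to the topology of pointwise convergence associated with the discrete topology on $X$.
   Context: For a topological group $G$ and $g\in G$ let $\lambda_g\colon G\to G,\ x\mapsto gx$. $\mathrm{LUCB}(G)$ is the algebra of bounded functions $f\colon G\to\mathbb{R}$ that are left-uniformly continuous, i.e., for every $\epsilon>0$ there is a neighborhood $U$ of the neutral element with $|f(x)-f(y)|\le\epsilon$ whenever $x^{-1}y\in U$. A mean on $\mathrm{LUCB}(G)$ is a positive linear functional $\mu$ with $\mu(\mathbf 1)=1$. $G$ is skew-amenable if $\mathrm{LUCB}(G)$ admits a mean $\mu$ with $\mu(f\circ\lambda_g)=\mu(f)$ for all $f\in\mathrm{LUCB}(G)$, $g\in G$. A linear order $\le$ on $X$ is dense if for all $x,y\in X$ with $x\le y$ and $x\neq y$ there is $z\in X\setminus\{x,y\}$ with $x\le z\le y$ (no assumption on endpoints). $\mathrm{Aut}(X,\le)$ is the group of order-automorphisms; in the stated topology, the pointwise stabilizers of finite subsets of $X$ form a neighborhood basis of the identity. *)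

(* Defs.v *)
From HB Require Import structures.
From mathcomp Require Import all_boot all_order all_algebra.
From mathcomp Require Import all_classical reals topology normedtype.

Set Implicit Arguments.
Unset Strict Implicit.
Unset Printing Implicit Defensive.

Import Order.TTheory GRing.Theory Num.Theory.
Import numFieldNormedType.Exports.

Local Open Scope classical_set_scope.
Local Open Scope ring_scope.

HB.mixin Record isTopologicalGroup G & Group G & Topological G := {
  mulg_continuous : continuous (fun p : G * G => (p.1 * p.2)%g) ;
  invg_continuous : continuous (fun x : G => (x^-1)%g)
}.

#[short(type="topologicalGroupType")]
HB.structure Definition TopologicalGroup :=
  {G of Group G & Topological G & isTopologicalGroup G}.

Definition left_uniformly_continuous (R : realType) (G : topologicalGroupType)
    (f : G -> R) : Prop :=
  forall eps : R, 0 < eps ->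
    exists2 U : set G, nbhs (1%g : G) U &
      forall x y : G, U (x^-1 * y)%g -> `|f x - f y| <= eps.

Definition lucb (R : realType) (G : topologicalGroupType) : {pred G -> R} :=
  mem [set f : G -> R | bounded_fun f /\ left_uniformly_continuous f].
Arguments lucb : clear implicits.

Section lucb_closed.
Context {R : realType} {G : topologicalGroupType}.
Implicit Types f h : G -> R.

Lemma lucbP f : reflect (bounded_fun f /\ left_uniformly_continuous f)
  (f \in lucb R G).
Proof. by apply: (iffP idP) => [/set_mem|/mem_set]. Qed.

Lemma lucb_bound f : f \in lucb R G ->
  exists2 M : R, 0 < M & forall x, `|f x| <= M.
Proof.
case/lucbP => bf _; have [M [Mreal MP]] := bf.
exists (`|M| + 1); first by rewrite ltr_wpDl.
by move=> x; apply: MP => //; rewrite (le_lt_trans (ler_norm _))// ltrDl.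
Qed.

Lemma bounded_funI f (M : R) : (forall x, `|f x| <= M) -> bounded_fun f.
Proof.
move=> fM; exists M; split; first exact: num_real.
by move=> N /ltW MN x _; apply: le_trans MN.
Qed.

Lemma lucb_cst (c : R) : (fun=> c) \in lucb R G.
Proof.
apply/lucbP; split; first exact: (@bounded_funI _ `|c|).
by move=> e e0; exists setT; [exact: filterT|move=> x y _; rewrite subrr normr0 ltW].
Qed.

Lemma lucbD f h : f \in lucb R G -> h \in lucb R G -> f + h \in lucb R G.
Proof.
move=> fL hL; apply/lucbP; split.
  have [[M _ fM] [N _ hN]] := (lucb_bound fL, lucb_bound hL).
  apply: (@bounded_funI _ (M + N)) => x.
  by rewrite (le_trans (ler_normD _ _))// lerD.
move=> e e0; have e2 : 0 < e / 2 by rewrite divr_gt0.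
have [[_ /(_ _ e2)[U U1 UP]] [_ /(_ _ e2)[V V1 VP]]] := (lucbP _ fL, lucbP _ hL).
exists (U `&` V); first exact: filterI.
move=> x y [Uxy Vxy]; rewrite /= [_ x]/(f x + h x) [_ y]/(f y + h y).
rewrite opprD addrACA (le_trans (ler_normD _ _))// (splitr e).
by rewrite lerD// ?UP ?VP.
Qed.

Lemma lucbM f h : f \in lucb R G -> h \in lucb R G -> f * h \in lucb R G.
Proof.
move=> fL hL.
have [[M M0 fM] [N N0 hN]] := (lucb_bound fL, lucb_bound hL).
apply/lucbP; split.
  apply: (@bounded_funI _ (M * N)) => x.
  by rewrite [_ x]/(f x * h x) normrM ler_pM.
move=> e e0.
have eN : 0 < e / 2 / N by rewrite !divr_gt0.
have eM : 0 < e / 2 / M by rewrite !divr_gt0.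
have [[_ /(_ _ eN)[U U1 UP]] [_ /(_ _ eM)[V V1 VP]]] := (lucbP _ fL, lucbP _ hL).
exists (U `&` V); first exact: filterI.
move=> x y [Uxy Vxy]; rewrite [_ x]/(f x * h x) [_ y]/(f y * h y).
have -> : f x * h x - f y * h y = (f x - f y) * h x + f y * (h x - h y).
  by rewrite mulrBl mulrBr addrA subrK.
rewrite (le_trans (ler_normD _ _))// (splitr e) !normrM lerD//.
  by rewrite -[leRHS](divfK (lt0r_neq0 N0)) ler_pM ?UP.
by rewrite -[leRHS](divfK (lt0r_neq0 M0)) mulrC ler_pM ?VP.
Qed.

Lemma lucb_submod_closed : submod_closed (lucb R G).
Proof.
split=> [|c f h fL hL]; first exact: (lucb_cst 0).
by apply: lucbD => //; apply: (lucbM (lucb_cst c)).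
Qed.

Lemma lucb_subring_closed : subring_closed (lucb R G).
Proof.
split=> [|f h fL hL|]; [exact: (lucb_cst 1)| |exact: lucbM].
apply: lucbD => //; have -> : - h = (fun=> -1) * h.
  by apply/funext => x; rewrite [RHS]mulN1r.
exact: lucbM (lucb_cst _) _.
Qed.

Lemma lucb_lmul (g : G) f : f \in lucb R G ->
  (fun x => f (g * x)%g) \in lucb R G.
Proof.
move=> fL; have [M _ fM] := lucb_bound fL; apply/lucbP; split.
  exact: (@bounded_funI _ M).
have [_ fu] := lucbP _ fL => e /fu[U U1 UP]; exists U => // x y Uxy.
by apply: UP; rewrite invgM mulgA -(mulgA x^-1%g) mulVg mulg1.
Qed.

End lucb_closed.

Record LUCB (R : realType) (G : topologicalGroupType) := MkLUCB {
  lucb_fun :> G -> R ;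
  _ : lucb_fun \in lucb R G
}.

HB.instance Definition _ (R : realType) (G : topologicalGroupType) :=
  [isSub for @lucb_fun R G].
HB.instance Definition _ (R : realType) (G : topologicalGroupType) :=
  [Choice of LUCB R G by <:].
HB.instance Definition _ (R : realType) (G : topologicalGroupType) :=
  GRing.SubChoice_isSubComPzRing.Build (G -> R) (lucb R G) (LUCB R G)
    lucb_subring_closed.
HB.instance Definition _ (R : realType) (G : topologicalGroupType) :=
  GRing.SubZmodule_isSubLmodule.Build R (G -> R) (lucb R G) (LUCB R G)
    lucb_submod_closed.

Definition lucb_translate (R : realType) (G : topologicalGroupType) (g : G)
    (f : LUCB R G) : LUCB R G :=
  MkLUCB (lucb_lmul g (valP f)).

(* Here [1 : LUCB R G] is the constant function 1. *)
Definition is_mean (R : realType) (G : topologicalGroupType)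
    (mu : {scalar LUCB R G}) : Prop :=
  (forall f : LUCB R G, (forall x, 0 <= f x) -> 0 <= mu f) /\ mu 1 = 1.

Definition skew_amenable (R : realType) (G : topologicalGroupType) : Prop :=
  exists2 mu : {scalar LUCB R G}, is_mean mu &
    forall (f : LUCB R G) (g : G), mu (lucb_translate g f) = mu f.

Definition dense_order d (X : orderType d) : Prop :=
  forall x y : X, (x <= y)%O -> x <> y ->
    exists z : X, [/\ z <> x, z <> y & (x <= z <= y)%O].

Record order_aut d (X : orderType d) := OrderAut {
  order_aut_fun :> X -> X ;
  order_aut_bij : bijective order_aut_fun ;
  order_aut_mono : {mono order_aut_fun : x y / (x <= y)%O}
}.

Section order_aut_group.
Context {d : Order.disp_t} {X : orderType d}.
Implicit Types g h k : order_aut X.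

Lemma order_autP g h : (forall x, g x = h x) -> g = h.
Proof.
case: g h => [g bg mg] [h bh mh] /= /funext gh; move: bg mg bh mh.
by rewrite gh => bg mg bh mh; congr OrderAut; exact: Prop_irrelevance.
Qed.

HB.instance Definition _ := gen_eqMixin (order_aut X).
HB.instance Definition _ := gen_choiceMixin (order_aut X).

Definition order_aut_one : order_aut X :=
  OrderAut (Bijective (fun=> erefl) (fun=> erefl)) (fun _ _ => erefl).

Lemma order_aut_mul_mono g h : {mono (g \o h) : x y / (x <= y)%O}.
Proof. by move=> x y; rewrite /= !order_aut_mono. Qed.

Definition order_aut_mul g h : order_aut X :=
  OrderAut (bij_comp (order_aut_bij g) (order_aut_bij h))
    (order_aut_mul_mono g h).

Lemma order_aut_inverse g : exists h : X -> X, cancel g h /\ cancel h g.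
Proof. by case: (order_aut_bij g) => h gK hK; exists h. Qed.

Definition order_aut_inv_fun g : X -> X := projT1 (cid (order_aut_inverse g)).

Lemma order_aut_inv_funK g : cancel g (order_aut_inv_fun g).
Proof. by case: (projT2 (cid (order_aut_inverse g))). Qed.

Lemma order_aut_inv_funVK g : cancel (order_aut_inv_fun g) g.
Proof. by case: (projT2 (cid (order_aut_inverse g))). Qed.

Lemma order_aut_inv_mono g : {mono order_aut_inv_fun g : x y / (x <= y)%O}.
Proof. by move=> x y; rewrite -(order_aut_mono g) !order_aut_inv_funVK. Qed.

Definition order_aut_inv g : order_aut X :=
  OrderAut (Bijective (order_aut_inv_funVK g) (order_aut_inv_funK g))
    (order_aut_inv_mono g).

Lemma order_aut_mulA : associative order_aut_mul.
Proof. by move=> g h k; exact: order_autP. Qed.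

Lemma order_aut_mul1 : left_id order_aut_one order_aut_mul.
Proof. by move=> g; exact: order_autP. Qed.

Lemma order_aut_mul1r : right_id order_aut_one order_aut_mul.
Proof. by move=> g; exact: order_autP. Qed.

Lemma order_aut_mulV : left_inverse order_aut_one order_aut_inv order_aut_mul.
Proof. by move=> g; apply: order_autP => x /=; exact: order_aut_inv_funK. Qed.

Lemma order_aut_mulVr : right_inverse order_aut_one order_aut_inv order_aut_mul.
Proof. by move=> g; apply: order_autP => x /=; exact: order_aut_inv_funVK. Qed.

HB.instance Definition _ := isGroup.Build (order_aut X)
  order_aut_mulA order_aut_mul1 order_aut_mul1r order_aut_mulV order_aut_mulVr.

(* Subspace topology inherited from the product of copies of discrete X;
   order_aut_nbhsP below gives the basis of neighborhoods it yields, at g = 1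
   the pointwise stabilizers of finite sets. *)
HB.instance Definition _ := Topological.copy (order_aut X)
  (initial_topology
    (@order_aut_fun d X : order_aut X -> {ptws X -> discrete_topology X})).

Lemma order_autM g h x : (g * h)%g x = g (h x). Proof. by []. Qed.
Lemma order_aut1 x : (1%g : order_aut X) x = x. Proof. by []. Qed.
Lemma order_autVK g : cancel (g^-1)%g g. Proof. exact: order_aut_inv_funVK. Qed.
Lemma order_autK g : cancel g (g^-1)%g. Proof. exact: order_aut_inv_funK. Qed.

Lemma order_aut_nbhs_eval g (x : X) : nbhs g [set h : order_aut X | h x = g x].
Proof.
have ce : continuous (fun h : order_aut X => h x : discrete_topology X).
  move=> h; apply: (@continuous_comp (order_aut X)
    {ptws X -> discrete_topology X} (discrete_topology X) _ (fun f => f x)).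
    exact: (@initial_continuous _ {ptws X -> discrete_topology X}).
  exact: (@proj_continuous X (fun=> discrete_topology X) x).
exact: (ce g _ (discrete_set1 (g x : discrete_topology X))).
Qed.

Lemma order_aut_nbhsP g (U : set (order_aut X)) :
  nbhs g U <-> exists s : seq X, forall h, {in s, h =1 g} -> U h.
Proof.
split; last first.
  case=> s sU; have : nbhs g [set h : order_aut X | {in s, h =1 g}].
    elim: s {sU} => [|x s IHs]; first by apply: filterS filterT => h _ y.
    apply: filterS (filterI (order_aut_nbhs_eval g x) IHs) => h [hx hs] y.
    by rewrite inE => /orP[/eqP->//|/hs].
  exact: filterS.
pose B (s : seq X) := [set h : order_aut X | {in s, h =1 g}].
pose F := filter_from [set: seq X] B.
have FF : Filter F.
  apply: filter_from_filter; first by exists [::].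
  move=> s t _ _; exists (s ++ t) => // h hst.
  by split=> x xs; apply: hst; rewrite mem_cat xs ?orbT.
have Fg : (@order_aut_fun d X @ F) --> (g : {ptws X -> discrete_topology X}).
  apply/(@cvg_sup _ _ (fun i : X => Topological.class (initial_topology
    (fun f : X -> discrete_topology X => f i)))) => x A.
  rewrite nbhsE => -[_ [[V _ <-] Vgx] VA]; exists [:: x] => // h hx.
  by apply: VA => /=; rewrite (hx x (mem_head _ _)).
case=> _ [[V oV <-] Vg] VU.
have [|s _ sV] := Fg V; first exact: open_nbhs_nbhs.
by exists s => h hs; apply: VU; exact: sV.
Qed.

Lemma order_aut_mul_continuous :
  continuous (fun p : order_aut X * order_aut X => (p.1 * p.2)%g).
Proof.
move=> [g h] /= U /order_aut_nbhsP[s sU].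
exists ([set g' : order_aut X | {in map h s, g' =1 g}],
        [set h' : order_aut X | {in s, h' =1 h}]).
  by split; apply/order_aut_nbhsP; [exists (map h s)|exists s].
move=> [g' h'] [/= gg hh]; apply: sU => x xs.
by rewrite !order_autM hh// gg// map_f.
Qed.

Lemma order_aut_inv_continuous :
  continuous (fun g : order_aut X => (g^-1)%g).
Proof.
move=> g U /order_aut_nbhsP[s sU]; apply/order_aut_nbhsP.
exists (map (g^-1)%g s) => h hs; apply: sU => x xs.
by apply: (can_inj (order_autK h)); rewrite order_autVK hs ?map_f// order_autVK.
Qed.

HB.instance Definition _ := isTopologicalGroup.Build (order_aut X)
  order_aut_mul_continuous order_aut_inv_continuous.

End order_aut_group.

(* Main.v *)
Require Import Defs.
From HB Require Import structures.
From mathcomp Require Import all_boot all_order all_algebra.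
From mathcomp Require Import all_classical reals topology normedtype.
From mathcomp Require Import lra.

Set Implicit Arguments.
Unset Strict Implicit.
Unset Printing Implicit Defensive.

Import Order.TTheory GRing.Theory Num.Theory.

Local Open Scope ring_scope.

(** The obstruction is a paradoxical decomposition of an orbit.

    For a point [q] and a set [S] of points, the function sending [g] to 1 if
    [g q] lies in [S] and to 0 otherwise depends on [g] only through [g q], so
    it is constant on left cosets of the open stabilizer of [q]; hence it is
    left-uniformly continuous however wild [S] is ([orbit_indicator_lucb]).
    Left translation by [k] replaces [S] by its preimage under [k].  A
    skew-invariant mean therefore induces a finitely additive probability
    measure on all subsets of the orbit of [q], invariant under the full
    automorphism group.

    No such measure exists.  Take [q] to be neither a least nor a greatest
    element.  By Cantor's theorem ([cantor_isomorphism]) the order without its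
    endpoints is a copy of the rationals, and automorphisms of that copy extend
    to the whole order by fixing the endpoints ([inner_aut_extension]).  Cut
    the rationals into three sets according to the third of the unit interval
    in which the fractional part lies.  Translation by 1/3 permutes them
    cyclically ([exists_rotation]), so each of them has measure 1/3.  But a
    piecewise affine automorphism that preserves integer parts compresses the
    first two thirds of every unit interval into the first and stretches the
    last third over the last two ([exists_squeeze]); it pulls the first set
    back to the union of the first two, so 1/3 would equal 2/3
    ([orbit_paradox]). *)

(** * Cantor's isomorphism theorem *)

Definition dense_unbounded d (X : orderType d) : Prop :=
  (forall x y : X, (x < y)%O -> exists2 z, (x < z)%O & (z < y)%O) /\
  (forall x : X, (exists y, (y < x)%O) /\ (exists y, (x < y)%O)).

Section Between.
Context d (Y : orderType d) (Y_du : dense_unbounded Y).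
Implicit Types (l r y : Y) (L R : seq Y).

Lemma exists_above_point l R : (forall r, r \in R -> (l < r)%O) ->
  exists2 y, (l < y)%O & forall r, r \in R -> (y < r)%O.
Proof.
have [Yd Yu] := Y_du; elim: R => [|r R IH] lR.
  by have [_ [y ly]] := Yu l; exists y.
have [|y ly yR] := IH; first by move=> r' r'R; apply: lR; rewrite inE r'R orbT.
have [|z lz zy] := Yd l (Order.min y r).
  by rewrite lt_min ly lR// mem_head.
move: zy; rewrite lt_min => /andP[zy zr]; exists z => // r'.
by rewrite inE => /orP[/eqP->//|/yR]; exact: lt_trans.
Qed.

(** The room needed in the back-and-forth construction: a cut between two
    finite sets can be filled, also when one or both of them are empty, which
    is where unboundedness and the point [y0] enter. *)
Lemma exists_between (y0 : Y) L R :
    (forall l r, l \in L -> r \in R -> (l < r)%O) ->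
  exists y, (forall l, l \in L -> (l < y)%O) /\
            (forall r, r \in R -> (y < r)%O).
Proof.
have [Yd Yu] := Y_du; elim: L => [_|l L IH lR].
  elim: R => [|r R [y [_ yR]]]; first by exists y0.
  have [[z zm] _] := Yu (Order.min y r).
  move: zm; rewrite lt_min => /andP[zy zr]; exists z; split=> // r'.
  by rewrite inE => /orP[/eqP->//|/yR]; exact: lt_trans.
have [|y [Ly yR]] := IH.
  by move=> l' r l'L; apply: lR; rewrite inE l'L orbT.
have [ly|yl] := ltP l y.
  by exists y; split=> // l'; rewrite inE => /orP[/eqP->//|/Ly].
have [|z lz zR] := @exists_above_point l R.
  by move=> r; apply: lR; rewrite mem_head.
exists z; split=> // l'; rewrite inE => /orP[/eqP->//|/Ly l'y].
exact: lt_trans (lt_le_trans l'y yl) lz.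
Qed.

End Between.

Section BackAndForth.
Context {d : Order.disp_t} {X : orderType d}.
Context {d' : Order.disp_t} {Y : orderType d'}.

Definition partial_iso (s : seq (X * Y)) : Prop :=
  {in s &, forall p q, (p.1 <= q.1)%O = (p.2 <= q.2)%O}.

(** A new [x] splits the finitely many points already matched into those below
    and those above it; their partners form a cut, and any point filling that
    cut can be matched with [x]. *)
Lemma partial_iso_forth (Y_du : dense_unbounded Y) (y0 : Y) s (x : X) :
  partial_iso s -> exists y, partial_iso ((x, y) :: s).
Proof.
move=> s_iso.
pose L := [seq p.2 | p <- s & (p.1 < x)%O].
pose R := [seq p.2 | p <- s & (x < p.1)%O].
have s_lt p q : p \in s -> q \in s -> (p.1 < q.1)%O = (p.2 < q.2)%O.
  by move=> ps qs; rewrite !ltNge s_iso.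
have [[p ps px]|xNs] := pselect (exists2 p, p \in s & p.1 = x).
  exists p.2; have -> : (x, p.2) = p by rewrite -px; case: (p).
  move=> u v; rewrite !inE.
  by move=> /orP[/eqP->|us] /orP[/eqP->|vs]; rewrite s_iso.
have [|y [Ly yR]] := @exists_between _ Y Y_du y0 L R.
  move=> l r /mapP[p]; rewrite mem_filter => /andP[px ps] ->.
  move=> /mapP[q]; rewrite mem_filter => /andP[xq qs] ->.
  by rewrite -s_lt// (lt_trans px).
have xy p : p \in s ->
    (p.1 <= x)%O = (p.2 <= y)%O /\ (x <= p.1)%O = (y <= p.2)%O.
  move=> ps; case: (ltgtP p.1 x) => [px|xp|px]; last by case: xNs; exists p.
    have py : (p.2 < y)%O.
      by apply: Ly; apply/mapP; exists p; rewrite ?mem_filter ?px.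
    by rewrite (ltW py) leNgt py.
  have yp : (y < p.2)%O.
    by apply: yR; apply/mapP; exists p; rewrite ?mem_filter ?xp.
  by rewrite (ltW yp) leNgt yp.
exists y => u v; rewrite !inE => /orP[/eqP->|us] /orP[/eqP->|vs] /=.
- by rewrite !lexx.
- by have [] := xy v vs.
- by have [] := xy u us.
- exact: s_iso.
Qed.

End BackAndForth.

Definition swap_pairs {A B : Type} (s : seq (A * B)) :=
  [seq (p.2, p.1) | p <- s].

Lemma partial_iso_swap d (X : orderType d) d' (Y : orderType d')
    (s : seq (X * Y)) :
  partial_iso s <-> partial_iso (swap_pairs s).
Proof.
split=> [s_iso _ _ /mapP[p ps ->] /mapP[q qs ->]|s_iso p q ps qs].
  by rewrite s_iso.
by have := s_iso (p.2, p.1) (q.2, q.1) (map_f _ ps) (map_f _ qs).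
Qed.

Section CantorTheorem.
Context {d : Order.disp_t} {X : orderType d}.
Context {d' : Order.disp_t} {Y : orderType d'}.
Hypotheses (X_du : dense_unbounded X) (Y_du : dense_unbounded Y).

Lemma partial_iso_back (x0 : X) (s : seq (X * Y)) (y : Y) :
  partial_iso s -> exists x, partial_iso ((x, y) :: s).
Proof.
move=> /partial_iso_swap/(partial_iso_forth X_du x0 y)[x xs].
by exists x; apply/partial_iso_swap.
Qed.

(** One round of back-and-forth: the points numbered [n] on either side enter
    the partial isomorphism.  Its hypothesis on [s] sits under the existential
    so that the choice of [s'] is a total function, which can be iterated. *)
Lemma partial_iso_step (x0 : X) (y0 : Y) (c : X -> nat) (e : Y -> nat) :
    injective c -> injective e -> forall (n : nat) (s : seq (X * Y)),
    exists s', partial_iso s ->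
    [/\ partial_iso s', {subset s <= s'},
        forall x, c x = n -> exists y, (x, y) \in s' &
        forall y, e y = n -> exists x, (x, y) \in s'].
Proof.
move=> c_inj e_inj n s.
have [s_iso|] := pselect (partial_iso s); last by exists s.
have [s1 [s1_iso ss1 s1P]] : exists s1, [/\ partial_iso s1, {subset s <= s1} &
    forall x, c x = n -> exists y, (x, y) \in s1].
  have [[x cx]|Nx] := pselect (exists x, c x = n); last first.
    by exists s; split=> // x cx; case: Nx; exists x.
  have [y ys] := partial_iso_forth Y_du y0 x s_iso.
  exists ((x, y) :: s); split=> // [p ps|z]; first by rewrite inE ps orbT.
  by rewrite -cx => /c_inj->; exists y; rewrite mem_head.
have [[y ey]|Ny] := pselect (exists y, e y = n); last first.
  by exists s1 => _; split=> // y ey; case: Ny; exists y.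
have [x xs] := partial_iso_back x0 y s1_iso.
exists ((x, y) :: s1) => _; split=> // [p ps|z cz|z].
- by rewrite inE ss1 ?orbT.
- by have [w zw] := s1P z cz; exists w; rewrite inE zw orbT.
- by rewrite -ey => /e_inj->; exists x; rewrite mem_head.
Qed.

(** The union of the partial isomorphisms [u n] is the graph of an
    isomorphism: the [n]-th round makes it total on both sides, and any two of
    its pairs already occur together in some [u n]. *)
Theorem cantor_isomorphism (x0 : X) (y0 : Y) :
    countable [set: X]%classic -> countable [set: Y]%classic ->
  exists (f : X -> Y) (g : Y -> X),
    [/\ cancel f g, cancel g f & {mono f : x y / (x <= y)%O}].
Proof.
move=> /countable_injP[c c_in] /countable_injP[e e_in].
have c_inj : injective c by move=> x y; apply: c_in; rewrite inE.
have e_inj : injective e by move=> x y; apply: e_in; rewrite inE.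
pose Step (p : nat * seq (X * Y)) := partial_iso_step x0 y0 c_inj e_inj p.1 p.2.
have [next nextP] := choice Step.
pose u := fix u n := if n is m.+1 then next (m, u m) else [::].
have u_iso n : partial_iso (u n).
  by elim: n => [|n IH] //; have [] := nextP (n, u n) IH.
have uP n := nextP (n, u n) (u_iso n).
have u_mono m n : (m <= n)%N -> {subset u m <= u n}.
  move=> /subnK<-; elim: (n - m)%N => [|k IH] p pm //.
  by rewrite addSn; have [_ + _ _] := uP (k + m)%N; apply; exact: IH.
have [f fP] : {f : X -> Y & forall x, exists n, (x, f x) \in u n}.
  apply: (@choice _ _ (fun x y => exists n, (x, y) \in u n)) => x.
  have [_ _ /(_ x erefl)[y xy] _] := uP (c x).
  by exists y, (c x).+1.
have [g gP] : {g : Y -> X & forall y, exists n, (g y, y) \in u n}.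
  apply: (@choice _ _ (fun y x => exists n, (x, y) \in u n)) => y.
  have [_ _ _ /(_ y erefl)[x xy]] := uP (e y).
  by exists x, (e y).+1.
have leE p q : (exists n, p \in u n) -> (exists n, q \in u n) ->
    (p.1 <= q.1)%O = (p.2 <= q.2)%O.
  move=> [m pm] [n qn]; apply: (u_iso (maxn m n)).
    exact: u_mono (leq_maxl _ _) _ pm.
  exact: u_mono (leq_maxr _ _) _ qn.
exists f, g; split=> [x|y|x y].
- apply: le_anti; have := leE _ _ (fP x) (gP (f x)).
  by have := leE _ _ (gP (f x)) (fP x); rewrite /= !lexx => -> ->.
- apply: le_anti; have := leE _ _ (fP (g y)) (gP y).
  by have := leE _ _ (gP y) (fP (g y)); rewrite /= !lexx => <- <-.
- exact: esym (leE _ _ (fP x) (fP y)).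
Qed.

End CantorTheorem.

(** * Removing the endpoints *)

Section Inner.
Context {d : Order.disp_t} {X : orderType d}.

Definition is_inner : pred X :=
  fun x => `[< (exists y, (y < x)%O) /\ (exists y, (x < y)%O) >].

Record inner := Inner { inner_val :> X ; _ : is_inner inner_val }.

HB.instance Definition _ := [isSub for inner_val].
HB.instance Definition _ := [Choice of inner by <:].
HB.instance Definition _ := [SubChoice_isSubOrder of inner by <: with d].

Lemma not_innerP (x : X) : ~~ is_inner x ->
  (forall y, (x <= y)%O) \/ (forall y, (y <= x)%O).
Proof.
move=> /asboolPn/not_andP[] /forallNP xN; [left|right] => y;
  by rewrite leNgt; apply/negP; exact: xN.
Qed.

(** An endpoint lies on the same side of all inner points, which is why moving
    the inner points among themselves and fixing the endpoints preserves the
    order. *)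
Lemma inner_vs_end (i j : inner) (y : X) : ~~ is_inner y ->
  (val i <= y)%O = (val j <= y)%O /\ (y <= val i)%O = (y <= val j)%O.
Proof.
move=> /not_innerP; have /asboolP[[a ai] [b ib]] := valP i.
have /asboolP[[a' aj] [b' jb]] := valP j => -[yle|ley].
  by rewrite !yle !leNgt (le_lt_trans (yle a) ai) (le_lt_trans (yle a') aj).
by rewrite !ley !leNgt (lt_le_trans ib (ley b)) (lt_le_trans jb (ley b')).
Qed.

Lemma order_aut_inner (g : order_aut X) (x : X) : is_inner x -> is_inner (g x).
Proof.
have g_lt y z : (g y < g z)%O = (y < z)%O by rewrite !ltNge order_aut_mono.
move=> /asboolP[[y yx] [z xz]]; apply/asboolP.
by split; [exists (g y)|exists (g z)]; rewrite g_lt.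
Qed.

Lemma dense_between (X_dense : dense_order X) (x y : X) :
  (x < y)%O -> exists2 z, (x < z)%O & (z < y)%O.
Proof.
move=> xy; have [|z [/eqP zx /eqP zy /andP[xz zy']]] := X_dense x y (ltW xy).
  by apply/eqP; rewrite lt_eqF.
by exists z; rewrite lt_neqAle ?xz ?zy' ?andbT // eq_sym.
Qed.

Lemma between_inner (x y z : X) : (x < z)%O -> (z < y)%O -> is_inner z.
Proof. by move=> xz zy; apply/asboolP; split; [exists x|exists y]. Qed.

Lemma inner_dense_unbounded : dense_order X -> dense_unbounded inner.
Proof.
move=> X_dense; have Xd := dense_between X_dense; split=> [x y xy|x].
  have [z xz zy] := Xd _ _ (xy : (val x < val y)%O).
  by exists (Inner (between_inner xz zy)).
have /asboolP[[y yx] [z xz]] := valP x; split.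
  by have [w yw wx] := Xd _ _ yx; exists (Inner (between_inner yw wx)).
by have [w xw wz] := Xd _ _ xz; exists (Inner (between_inner xw wz)).
Qed.

Lemma inner_countable :
  countable [set: X]%classic -> countable [set: inner]%classic.
Proof.
move=> /countable_injP[c c_inj]; apply/countable_injP; exists (c \o val).
by move=> x y _ _ /= /c_inj cxy; apply: val_inj; apply: cxy; rewrite inE.
Qed.

Lemma inner_inhabited :
  dense_order X -> infinite_set [set: X]%classic -> inhabited inner.
Proof.
move=> X_dense X_inf; apply: contrapT => Nin; apply: X_inf.
have [[x _]|Nx] := pselect (exists x : X, True); last first.
  by apply: (sub_finite_set _ (finite_set0 X)) => x _; case: Nx; exists x.
apply: (sub_finite_set _ (finite_set1 x)) => y _ /=; apply: contrapT => yx.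
have : (x < y)%O || (y < x)%O by rewrite -neq_lt eq_sym; apply/eqP.
by case/orP => /(dense_between X_dense)[z h k]; apply: Nin;
  exists; exact: Inner (between_inner h k).
Qed.

(** An automorphism of any copy [Y] of the inner part is realized on the whole
    order, by conjugating it with the isomorphism and fixing the endpoints. *)
Lemma inner_aut_extension {d' : Order.disp_t} {Y : orderType d'}
    (f : inner -> Y) (f' : Y -> inner) :
    cancel f f' -> cancel f' f -> {mono f : x y / (x <= y)%O} ->
  forall g : order_aut Y, exists h : order_aut X,
    forall i : inner, h (val i) = val (f' (g (f i))).
Proof.
move=> fK f'K f_mono g.
pose ext (k : order_aut Y) (x : X) :=
  if insub x is Some i then val (f' (k (f i))) else x.
have extE k (i : inner) : ext k (val i) = val (f' (k (f i))).
  by rewrite /ext valK.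
have extN k x : ~~ is_inner x -> ext k x = x by move=> Nx; rewrite /ext insubN.
have extK (k k' : order_aut Y) : cancel k k' -> cancel (ext k) (ext k').
  move=> kK x; have [xi|Nx] := boolP (is_inner x); last by rewrite !extN.
  by rewrite -[x]/(val (Inner xi)) !extE f'K kK fK.
have ext_mono k : {mono ext k : x y / (x <= y)%O}.
  have f'_mono : {mono f' : x y / (x <= y)%O}.
    by move=> x y; rewrite -f_mono !f'K.
  move=> x y; case: (insubP inner x) => [i _ <-|Nx];
    case: (insubP inner y) => [j _ <-|Ny].
  - rewrite !extE -[LHS]/(f' (k (f i)) <= f' (k (f j)))%O.
    by rewrite f'_mono order_aut_mono f_mono.
  - by rewrite extE (extN _ _ Ny); case: (inner_vs_end (f' (k (f i))) i Ny).
  - by rewrite extE (extN _ _ Nx); case: (inner_vs_end (f' (k (f j))) j Nx).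
  - by rewrite !extN.
have gK : cancel (ext g) (ext g^-1%g) by apply: extK; exact: order_autK.
have gVK : cancel (ext g^-1%g) (ext g) by apply: extK; exact: order_autVK.
by exists (OrderAut (Bijective gK gVK) (ext_mono g)) => i; exact: extE.
Qed.

End Inner.

(** * Two automorphisms of the rationals *)

Section PeriodicMaps.
Implicit Types (p : rat -> rat) (x y r : rat).

Definition frac x : rat := x - (Num.floor x)%:~R.

Lemma frac_itv x : 0 <= frac x < 1.
Proof.
have := floor_itv x; rewrite /frac intrD => /andP[h k]; apply/andP; split; lra.
Qed.

Lemma floor_frac_add (m : int) r : 0 <= r < 1 ->
  Num.floor (m%:~R + r) = m /\ frac (m%:~R + r) = r.
Proof.
move=> /andP[r0 r1]; have fl : Num.floor (m%:~R + r) = m.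
  by apply: floor_def; rewrite intrD; apply/andP; split; lra.
by rewrite /frac fl; split=> //; lra.
Qed.

(** The map that acts on every interval from an integer to the next one as [p]
    acts between 0 and 1. *)
Definition periodic_map p x : rat := (Num.floor x)%:~R + p (frac x).

Lemma periodic_mapK p p' : (forall r, 0 <= r < 1 -> 0 <= p r < 1) ->
    (forall r, 0 <= r < 1 -> p' (p r) = r) ->
  cancel (periodic_map p) (periodic_map p').
Proof.
move=> p01 pK x; have f01 := frac_itv x; rewrite {1}/periodic_map.
have [-> ->] := floor_frac_add (Num.floor x) (p01 _ f01).
by rewrite pK// /frac; lra.
Qed.

Lemma periodic_map_mono p : (forall r, 0 <= r < 1 -> 0 <= p r < 1) ->
    (forall r s, r < s -> p r < p s) ->
  {mono periodic_map p : x y / (x <= y)%O}.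
Proof.
move=> p01 p_mono; apply: le_mono => x y xy; rewrite /periodic_map.
have /andP[px0 px1] := p01 _ (frac_itv x).
have /andP[py0 py1] := p01 _ (frac_itv y).
have := le_floor (ltW xy); rewrite le_eqVlt => /orP[/eqP flxy|].
  by rewrite flxy ltrD2l; apply: p_mono; rewrite /frac flxy ltrD2r.
rewrite -lezD1 -(ler_int rat) intrD => flxy; lra.
Qed.

Definition first_third : pred rat := fun x => frac x < 1/3.
Definition middle_third : pred rat := fun x => 1/3 <= frac x < 2/3.
Definition last_third : pred rat := fun x => 2/3 <= frac x.

Lemma thirds_partition x :
  (first_third x + middle_third x + last_third x = 1)%N.
Proof.
rewrite /first_third /middle_third /last_third.
case: ltP => a; case: ltP => b //=; exfalso; lra.
Qed.

(** On the fractional part, the squeeze is the increasing bijection of the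
    half-open unit interval that is affine on either side of 2/3 and sends 2/3
    to 1/3.  Being convex, it is the maximum of its two affine pieces, and its
    inverse is the minimum of their inverses. *)
Lemma exists_squeeze : exists h : order_aut rat,
  forall x, (first_third (h x) = first_third x + middle_third x :> nat)%N.
Proof.
pose p r : rat := Num.max (r / 2) (2 * r - 1).
pose p' r : rat := Num.min (2 * r) ((r + 1) / 2).
have p01 r : 0 <= r < 1 -> 0 <= p r < 1.
  rewrite /p => /andP[r0 r1].
  by case: (leP (r / 2)) => h; apply/andP; split; lra.
have p'01 r : 0 <= r < 1 -> 0 <= p' r < 1.
  rewrite /p' => /andP[r0 r1].
  by case: (leP (2 * r)) => h; apply/andP; split; lra.
have pK r : p' (p r) = r.
  by rewrite /p; case: (leP (r / 2)) => h; rewrite /p'; case: leP => k; lra.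
have p'K r : p (p' r) = r.
  by rewrite /p'; case: leP => h; rewrite /p; case: leP => k; lra.
have p_mono r s : r < s -> p r < p s.
  by rewrite /p; case: (leP (r / 2)) => h; case: (leP (s / 2)) => k rs; lra.
have hK : cancel (periodic_map p) (periodic_map p') by exact: periodic_mapK.
have h'K : cancel (periodic_map p') (periodic_map p) by exact: periodic_mapK.
exists (OrderAut (Bijective hK h'K) (periodic_map_mono p01 p_mono)) => x.
rewrite /first_third /middle_third /=.
have [_ ->] := floor_frac_add (Num.floor x) (p01 _ (frac_itv x)).
have -> : (p (frac x) < 1/3) = (frac x < 2/3).
  by rewrite /p; case: (leP (_ / 2)) => h; apply/idP/idP => k; lra.
by case: (ltP _ (1/3)) => a; case: ltP => b //=; exfalso; lra.
Qed.

Lemma exists_rotation : exists t : order_aut rat,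
  forall x, middle_third (t x) = first_third x /\
            last_third (t x) = middle_third x.
Proof.
have tK : cancel (fun x : rat => x + 1/3) (fun x => x - 1/3).
  by move=> x; rewrite addrK.
have t'K : cancel (fun x : rat => x - 1/3) (fun x => x + 1/3).
  by move=> x; rewrite subrK.
have t_mono : {mono (fun x : rat => x + 1/3) : x y / (x <= y)%O}.
  by move=> x y; rewrite lerD2r.
exists (OrderAut (Bijective tK t'K) t_mono) => x.
rewrite /first_third /middle_third /last_third /=.
have /andP[f0 f1] := frac_itv x.
have xE : x = (Num.floor x)%:~R + frac x by rewrite /frac; lra.
(* Adding 1/3 carries into the integer part exactly on the last third. *)
have [f23|f23] := ltP (frac x) (2/3).
  have /(floor_frac_add (Num.floor x))[_] : 0 <= frac x + 1/3 < 1.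
    by apply/andP; split; lra.
  by rewrite addrA -xE => ->; split; apply/idP/idP => h; lra.
have /(floor_frac_add (Num.floor x + 1))[_] : 0 <= frac x - 2/3 < 1.
  by apply/andP; split; lra.
have -> : (Num.floor x + 1)%:~R + (frac x - 2/3) = x + 1/3.
  by rewrite intrD; lra.
by move=> ->; split; apply/idP/idP => h; lra.
Qed.

End PeriodicMaps.

(** * Invariant means and orbits *)

Section OrbitIndicators.
Context {R : realType} {d : Order.disp_t} {X : orderType d}.

(** If [g^-1 * h] fixes [q] then [g q] and [h q] coincide: the stabilizer of [q]
    is a uniformity neighborhood that works for every [eps]. *)
Lemma orbit_indicator_lucb (q : X) (A : pred X) :
  (fun g : order_aut X => (A (g q))%:R) \in lucb R (order_aut X).
Proof.
apply/lucbP; split.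
  by apply: (@bounded_funI _ _ _ 1) => g; case: (A _); rewrite ?normr1 ?normr0.
move=> e e0; exists [set k : order_aut X | k q = q]%classic.
  exact: (order_aut_nbhs_eval 1%g q).
move=> g h /= ghq; have -> : h q = g q.
  by rewrite -[RHS](congr1 g ghq) [RHS](order_autVK g).
by rewrite subrr normr0 ltW.
Qed.

Definition orbit_indicator (q : X) (A : pred X) : LUCB R (order_aut X) :=
  MkLUCB (orbit_indicator_lucb q A).

(** The translation [t] forces the three parts of the orbit to have the same
    mass, hence positive mass, whereas [h] forces the part [B] to be null. *)
Lemma orbit_paradox (q : X) (A B C : pred X) (t h : order_aut X) :
    (forall g : order_aut X, let x := g q in
       [/\ A x + B x + C x = 1, B (t x) = A x, C (t x) = B x &
           A (h x) = A x + B x :> nat]%N) ->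
  ~ skew_amenable R (order_aut X).
Proof.
move=> ABC [mu [_ mu1] mu_inv].
pose m (S : pred X) := mu (orbit_indicator q S).
have mE (k : order_aut X) (S T : pred X) :
    (forall g : order_aut X, S (k (g q)) = T (g q)) -> m S = m T.
  move=> ST; rewrite /m -(mu_inv _ k); congr (mu _).
  by apply: val_inj; apply/funext => g /=; rewrite ST.
have mBA : m B = m A by apply: (mE t) => g; have [] := ABC g.
have mCB : m C = m B by apply: (mE t) => g; have [] := ABC g.
have mD : m A = m A + m B.
  rewrite {1}/m -(mu_inv _ h) -raddfD; congr (mu _).
  apply: val_inj; apply/funext => g; have [_ _ _ E] := ABC g.
  by rewrite /= E natrD.
have m1 : m A + m B + m C = 1.
  rewrite -mu1 -!raddfD; congr (mu _).
  apply: val_inj; apply/funext => g; have [E _ _ _] := ABC g.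
  by rewrite [LHS]/= -[RHS]/(1%:R : R) -E !natrD.
lra.
Qed.

End OrbitIndicators.

Theorem proposition9p6 (R : realType) (d : Order.disp_t) (X : orderType d)
  (X_countable : countable [set: X]%classic)
  (X_infinite : infinite_set [set: X]%classic)
  (X_dense : dense_order X) :
  ~ skew_amenable R (order_aut X).
Proof.
have [i0] := inner_inhabited X_dense X_infinite.
have rat_du : dense_unbounded rat.
  split=> [x y xy|x]; first by exists ((x + y) / 2); lra.
  by split; [exists (x - 1)|exists (x + 1)]; lra.
have [f [f' [fK f'K f_mono]]] := cantor_isomorphism
  (inner_dense_unbounded X_dense) rat_du i0 0 (inner_countable X_countable)
  (countableP _).
have [t0 t0P] := exists_rotation; have [h0 h0P] := exists_squeeze.
have [t tP] := inner_aut_extension fK f'K f_mono t0.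
have [h hP] := inner_aut_extension fK f'K f_mono h0.
(* [false] is a default for endpoints: the orbit of an inner point is inner. *)
pose on_inner (S : pred rat) (x : X) :=
  if insub x is Some i then S (f i) else false.
have onE S (i : inner) : on_inner S (val i) = S (f i).
  by rewrite /on_inner valK.
apply: (@orbit_paradox R _ _ (val i0) (on_inner first_third)
  (on_inner middle_third) (on_inner last_third) t h) => g x.
have [i ->] : exists i : inner, x = val i.
  by exists (Inner (order_aut_inner g (valP i0))).
rewrite tP hP !onE !f'K h0P thirds_partition.
by have [-> ->] := t0P (f i).
Qed.
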